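(* Let $(x,y,a)$ be a primitive Pythagorean triple with $x$ odd and $y$ even, and let $k$ be a positive integer. In the Pythagorean triple $(kx,ky,ka)$ with common multiplier $k$, the thickness of each gnomon is $k$ times the thickness of the corresponding gnomon of $(x,y,a)$, and the middle terms of the arithmetic progressions describing the corresponding gnomons are also multiplied by $k$: $$T_{kx}=kT_x,\qquad T_{ky}=kT_y,\qquad s_{kx}=ks_x,\qquad s_{ky}=ks_y .$$
   Context: For a Pythagorean triple $(X,Y,A)$ of positive integers ($X^2+Y^2=A^2$), the gnomon $G_X$ is the L-shaped figure that completes a square of side $Y$ to a square of side $A$; its area is $X^2$ and its thickness is $T_X=A-Y$. It is the union of $T_X$ consecutive gnomons of thickness $1$ with areas $2Y+1,2Y+3,\dots,2A-1$, an arithmetic progression with difference $2$ and $T_X$ terms, which is said to describe $G_X$. The middle term $s_X$ of this progression means the arithmetic mean of its terms, $s_X=X^2/T_X$. The gnomon $G_Y$, its thickness $T_Y=A-X$ and the middle term $s_Y=Y^2/T_Y$ are defined in the same way with the roles of $X$ and $Y$ interchanged. The quantities $T_x,T_y,s_x,s_y$ refer to the triple $(x,y,a)$, and $T_{kx},T_{ky},s_{kx},s_{ky}$ to the triple $(kx,ky,ka)$. *)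

(* Defs.v *)
From mathcomp Require Import all_boot all_order all_algebra.

Set Implicit Arguments.
Unset Strict Implicit.
Unset Printing Implicit Defensive.

Import GRing.Theory.

Definition pythagorean_triple (X Y A : nat) : Prop :=
  [/\ 0 < X, 0 < Y, 0 < A & X ^ 2 + Y ^ 2 = A ^ 2].

Definition primitive_triple (X Y A : nat) : Prop :=
  pythagorean_triple X Y A /\ gcdn (gcdn X Y) A = 1.

(* Below, a gnomon is given by the side [inner] of the square it surrounds and
   the side [outer] of the square it completes.  The subtraction on [nat] is
   exact, since a leg of a Pythagorean triple is smaller than the hypotenuse. *)
Definition thickness (inner outer : nat) : nat := outer - inner.

(* The thickness-1 gnomon completing a square of side m to one of side m + 1
   has area 2 m + 1; letting m range over inner <= m < outer gives the terms
   2 inner + 1, 2 inner + 3, ..., 2 outer - 1. *)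
Definition gnomon_progression (inner outer : nat) : seq nat :=
  [seq 2 * m + 1 | m <- index_iota inner outer].

Definition arithmetic_mean (s : seq nat) : rat :=
  ((\sum_(t <- s) t%:R) / (size s)%:R)%R.

(* G_X surrounds the square of side Y; G_Y surrounds the square of side X. *)
Definition T_X (X Y A : nat) : nat := thickness Y A.
Definition T_Y (X Y A : nat) : nat := thickness X A.

Definition s_X (X Y A : nat) : rat :=
  arithmetic_mean (gnomon_progression Y A).
Definition s_Y (X Y A : nat) : rat :=
  arithmetic_mean (gnomon_progression X A).

(* Main.v *)
(* The terms of a gnomon progression from side [i] to side [o] telescope as
   (m + 1)^2 - m^2, so their sum is o^2 - i^2 = (o - i) (o + i) and their mean
   is o + i, which is homogeneous of degree one in (i, o). *)
Require Import Defs.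
From mathcomp Require Import all_boot all_order all_algebra.
From mathcomp Require Import ring.

Import Order.TTheory GRing.Theory Num.Theory.

Lemma sum_gnomon_progression (i o : nat) : i <= o ->
  (\sum_(t <- gnomon_progression i o) t%:R = o%:R ^+ 2 - i%:R ^+ 2 :> rat)%R.
Proof.
move=> le_io; rewrite big_map.
rewrite -(telescope_sumr (fun m : nat => m%:R ^+ 2 : rat)%R le_io).
by apply: eq_bigr => m _; rewrite natrD natrM -natr1; ring.
Qed.

(** Strictness matters: for [i = o] the progression is empty and its mean is 0 / 0 = 0 in [rat], not
    [o + i]. *)
Lemma arithmetic_mean_gnomon_progression (i o : nat) : i < o ->
  arithmetic_mean (gnomon_progression i o) = (o + i)%:R%R.
Proof.
move=> lt_io; have le_io := ltnW lt_io.
rewrite /arithmetic_mean sum_gnomon_progression // size_map size_iota.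
(* By [le_io], the length [o - i] casts to the exact rational difference, a factor of the sum that
   cancels. *)
rewrite subr_sqr -natrB // -natrD mulrC mulKf //.
by rewrite pnatr_eq0 -lt0n subn_gt0.
Qed.

Lemma arithmetic_mean_gnomon_progression_scale (k i o : nat) :
    0 < k -> i < o ->
  (arithmetic_mean (gnomon_progression (k * i) (k * o)) =
     k%:R * arithmetic_mean (gnomon_progression i o))%R.
Proof.
move=> k_gt0 lt_io; rewrite !arithmetic_mean_gnomon_progression //.
  by rewrite -mulnDr natrM.
by rewrite ltn_pmul2l.
Qed.

(** Ensures that both gnomon progressions are nonempty. *)
Lemma pythagorean_triple_ltn (x y a : nat) :
  pythagorean_triple x y a -> x < a /\ y < a.
Proof.
case=> x_gt0 y_gt0 _ def_a.
rewrite -(ltn_sqr x) -(ltn_sqr y) -def_a.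
(* Adding 0 to each left side lets the common square cancel, leaving the other leg's square to be
   positive. *)
by rewrite -[ltnLHS]addn0 ltn_add2l -[X in _ /\ X < _]add0n ltn_add2r !expn_gt0
  x_gt0 y_gt0.
Qed.

Lemma pythagorean_triple_scale (k x y a : nat) : 0 < k ->
  pythagorean_triple x y a -> pythagorean_triple (k * x) (k * y) (k * a).
Proof.
move=> k_gt0 [x_gt0 y_gt0 a_gt0 def_a]; split; rewrite ?muln_gt0 ?k_gt0 //.
by rewrite !expnMn -mulnDr def_a.
Qed.

Theorem theorem4 (x y a k : nat)
    (hprim : primitive_triple x y a)
    (hx : odd x) (hy : ~~ odd y) (hk : 0 < k) :
  pythagorean_triple (k * x) (k * y) (k * a) /\
  [/\ T_X (k * x) (k * y) (k * a) = k * T_X x y a,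
      T_Y (k * x) (k * y) (k * a) = k * T_Y x y a,
      s_X (k * x) (k * y) (k * a) = (k%:R * s_X x y a)%R
    & s_Y (k * x) (k * y) (k * a) = (k%:R * s_Y x y a)%R].
Proof.
have [hxya _] := hprim.
have [lt_xa lt_ya] := pythagorean_triple_ltn _ _ _ hxya.
split; first exact: pythagorean_triple_scale.
(* Thicknesses scale by distributivity over subtraction, means by [lt_ya] and [lt_xa]. *)
split; [exact/esym/mulnBr | exact/esym/mulnBr | |];
  exact: arithmetic_mean_gnomon_progression_scale.
Qed.
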